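(* Let $\bar x \in M$ be a feasible point of MPCC that fulfills MPCC-LICQ. Then DISJ-LICQ holds at all feasible points $x \in M^{\text{D}(t)}$ of the disjunctive regularization $\text{D}(t)$ for all sufficiently small $t>0$, whenever they are sufficiently close to $\bar x$. (That is, there exist $\bar t>0$ and a neighborhood $U$ of $\bar x$ such that for all $t\in(0,\bar t)$ every $x\in M^{\text{D}(t)}\cap U$ satisfies DISJ-LICQ.)
   Context: Let $F_1,F_2\in C^2(\mathbb{R}^n,\mathbb{R}^\kappa)$, $f\in C^2(\mathbb{R}^n,\mathbb{R})$. MPCC is the problem $\min f(x)$ s.t. $x\in M$ with $M=\{x\in\mathbb{R}^n \mid F_{1,j}(x)\cdot F_{2,j}(x)=0,\ F_{1,j}(x)\ge 0,\ F_{2,j}(x)\ge 0,\ j=1,\ldots,\kappa\}$. For $t>0$, the disjunctive regularization $\text{D}(t)$ is the problem $\min f(x)$ s.t. $x\in M^{\text{D}(t)}$ with $M^{\text{D}(t)}=\{x\in\mathbb{R}^n \mid \max\{t-F_{1,j}(x),t-F_{2,j}(x)\}\ge 0,\ F_{1,j}(x)\ge 0,\ F_{2,j}(x)\ge 0,\ j=1,\ldots,\kappa\}$. For $\bar x\in M$: $a_{01}(\bar x)=\{j\mid F_{1,j}(\bar x)=0,F_{2,j}(\bar x)>0\}$, $a_{10}(\bar x)=\{j\mid F_{1,j}(\bar x)>0,F_{2,j}(\bar x)=0\}$, $a_{00}(\bar x)=\{j\mid F_{1,j}(\bar x)=0,F_{2,j}(\bar x)=0\}$. MPCC-LICQ at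 $\bar x\in M$: the vectors $\nabla F_{1,j}(\bar x)$, $j\in a_{01}(\bar x)\cup a_{00}(\bar x)$, together with $\nabla F_{2,j}(\bar x)$, $j\in a_{10}(\bar x)\cup a_{00}(\bar x)$, are linearly independent. For $x\in M^{\text{D}(t)}$: $\mathcal{H}_{12}(x)=\{j\mid F_{1,j}(x)=F_{2,j}(x)=t\}$, $\mathcal{H}_{1}(x)=\{j\mid F_{1,j}(x)=t,F_{2,j}(x)>t\}$, $\mathcal{H}_{2}(x)=\{j\mid F_{1,j}(x)>t,F_{2,j}(x)=t\}$, $\mathcal{N}_1(x)=\{j\mid F_{1,j}(x)=0\}$, $\mathcal{N}_2(x)=\{j\mid F_{2,j}(x)=0\}$. DISJ-LICQ at $x\in M^{\text{D}(t)}$: the vectors $\nabla F_{1,j}(x)$, $j\in\mathcal{H}_{12}(x)\cup\mathcal{H}_1(x)\cup\mathcal{N}_1(x)$, together with $\nabla F_{2,j}(x)$, $j\in\mathcal{H}_{12}(x)\cup\mathcal{H}_2(x)\cup\mathcal{N}_2(x)$, are linearly independent. *)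

(* Defs.v *)
From mathcomp Require Import all_boot all_order all_algebra.
From mathcomp Require Import all_classical all_reals all_analysis.

Set Implicit Arguments.
Unset Strict Implicit.
Unset Printing Implicit Defensive.

Import Order.TTheory GRing.Theory Num.Theory.
Import numFieldNormedType.Exports.

Local Open Scope ring_scope.

Section Calculus.
Context {R : realType} {n : nat}.

(* C^k on the whole space: all iterated partial derivatives of order at most k
   exist everywhere and are continuous. *)
Fixpoint Ck {W : normedModType R} (k : nat) (g : 'rV[R]_n -> W) : Prop :=
  continuous g /\
  (if k is k'.+1 then
     forall i : 'I_n, (forall x, derivable g x (delta_mx ord0 i)) /\
                      Ck k' ('D_(delta_mx ord0 i) g)
   else True).

Definition gradient (g : 'rV[R]_n -> R) (x : 'rV[R]_n) : 'rV[R]_n :=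
  \row_(i < n) 'D_(delta_mx ord0 i) g x.

Definition component {kappa : nat} (F : 'rV[R]_n -> 'rV[R]_kappa)
  (j : 'I_kappa) : 'rV[R]_n -> R := fun x => F x ord0 j.

End Calculus.

Section MPCC.
Context {R : realType} {n kappa : nat}.
Variables F1 F2 : 'rV[R]_n -> 'rV[R]_kappa.
Implicit Types (x : 'rV[R]_n) (t : R).

Local Notation "F1_[ j ]" := (component F1 j).
Local Notation "F2_[ j ]" := (component F2 j).

Definition mpcc_feasible : set 'rV[R]_n :=
  [set x | forall j : 'I_kappa,
    [/\ F1_[j] x * F2_[j] x = 0, 0 <= F1_[j] x & 0 <= F2_[j] x]]%classic.

Definition disj_feasible t : set 'rV[R]_n :=
  [set x | forall j : 'I_kappa,
    [/\ 0 <= Num.max (t - F1_[j] x) (t - F2_[j] x),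
        0 <= F1_[j] x & 0 <= F2_[j] x]]%classic.

Definition a01 x : {set 'I_kappa} := [set j | (F1_[j] x == 0) && (0 < F2_[j] x)]%SET.
Definition a10 x : {set 'I_kappa} := [set j | (0 < F1_[j] x) && (F2_[j] x == 0)]%SET.
Definition a00 x : {set 'I_kappa} := [set j | (F1_[j] x == 0) && (F2_[j] x == 0)]%SET.

Definition H12 t x : {set 'I_kappa} := [set j | (F1_[j] x == t) && (F2_[j] x == t)]%SET.
Definition H1 t x : {set 'I_kappa} := [set j | (F1_[j] x == t) && (t < F2_[j] x)]%SET.
Definition H2 t x : {set 'I_kappa} := [set j | (t < F1_[j] x) && (F2_[j] x == t)]%SET.
Definition N1 x : {set 'I_kappa} := [set j | F1_[j] x == 0]%SET.
Definition N2 x : {set 'I_kappa} := [set j | F2_[j] x == 0]%SET.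

(* Gradients listed as an indexed family: [free] of the concatenated sequence
   fails as soon as two gradients with different indices coincide. *)
Definition gradient_family (J1 J2 : {set 'I_kappa}) x : seq 'rV[R]_n :=
  [seq gradient F1_[j] x | j <- enum J1] ++ [seq gradient F2_[j] x | j <- enum J2].

Definition MPCC_LICQ x : Prop :=
  free (gradient_family (a01 x :|: a00 x)%SET (a10 x :|: a00 x)%SET x).

Definition DISJ_LICQ t x : Prop :=
  free (gradient_family (H12 t x :|: H1 t x :|: N1 x)%SET
                        (H12 t x :|: H2 t x :|: N2 x)%SET x).

End MPCC.

(* Main.v *)
(* A function F_{i,j} positive at xbar stays above some e > 0 near xbar. Hence
   for t < e any constraint active at x in the sense of D(t), i.e. F_{i,j}(x)
   equal to t or 0, vanishes at xbar: the DISJ-LICQ family at x is a subfamily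
   of the MPCC-LICQ index set, with gradients taken at x. Linear independence
   of the continuous gradients persists from xbar to nearby x. *)
Require Import Defs.
From mathcomp Require Import all_boot all_order all_algebra.
From mathcomp Require Import all_classical all_reals all_analysis.
Import Order.TTheory GRing.Theory Num.Theory.
Import numFieldNormedType.Exports.
Local Open Scope ring_scope.

Set Implicit Arguments.
Unset Strict Implicit.
Unset Printing Implicit Defensive.

(** A free sequence has no repetitions, so a subsequence of it is a filter of it by membership. *)
Lemma subseq_free (K : fieldType) (V : vectType K) (X Y : seq V) :
  subseq X Y -> free Y -> free X.
Proof.
move=> XY freeY; have /(subseq_uniqP (free_uniq freeY)) -> := XY.
exact: filter_free.
Qed.

Lemma subset_subseq_enum (T : finType) (A B : {set T}) :
  A \subset B -> subseq (enum A) (enum B).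
Proof.
move=> /fintype.subsetP AB.
rewrite [enum A](_ : _ = [seq x <- enum B | x \in A]) ?filter_subseq//.
rewrite /enum_mem -filter_predI; apply: eq_filter => x /=.
by case: (boolP (x \in A)) => //= /AB ->.
Qed.

(** Left multiplication by the matrix with rows [X] forms linear combinations of [X], so both sides
    say that it is injective. *)
Lemma free_row_freeE (K : fieldType) (m n : nat) (X : m.-tuple 'rV[K]_n) :
  free X = row_free (\matrix_(i < m) X`_i).
Proof.
have sumE (k : 'rV[K]_m) :
    k *m (\matrix_(i < m) X`_i) = \sum_(i < m) k 0 i *: X`_i.
  by rewrite mulmx_sum_row; apply: eq_bigr => i _; rewrite rowK.
apply/idP/idP => [/freeP freeX|freeM].
  apply: inj_row_free => v; rewrite sumE => /freeX v0.
  by apply/rowP => i; rewrite mxE v0.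
apply/freeP => k k0 i.
have : (\row_i k i) *m (\matrix_(i < m) X`_i) = 0 *m (\matrix_(i < m) X`_i).
  by rewrite mul0mx sumE -[RHS]k0; apply: eq_bigr => j _; rewrite mxE.
by move=> /(row_free_injr freeM)/rowP/(_ i); rewrite !mxE.
Qed.

Section Topology.
Local Open Scope classical_set_scope.

(** By the Leibniz formula, the determinant is a finite sum of signed products of entries. *)
Lemma cvg_det (R : realType) (T : Type) (F : set_system T) {FF : Filter F}
    (m : nat) (A : T -> 'M[R]_m) (B : 'M[R]_m) :
  (forall i j, A x i j @[x --> F] --> B i j) ->
  \det (A x) @[x --> F] --> \det B.
Proof.
move=> AB; apply: cvg_big => [|s _]; first exact: add_continuous.
apply: cvgM; first exact: cvg_cst.
by apply: cvg_big => [|i _]; [exact: mul_continuous|exact: AB].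
Qed.

(* A right inverse [C] of the matrix at the limit makes [det (A x *m C)] close
   to [1], hence [A x] keeps full row rank. *)
Lemma near_row_free (R : realType) (T : Type) (F : set_system T)
    {FF : Filter F} (m n : nat) (A : T -> 'M[R]_(m, n)) (B : 'M[R]_(m, n)) :
  (forall i j, A x i j @[x --> F] --> B i j) ->
  row_free B -> \forall x \near F, row_free (A x).
Proof.
move=> AB /row_freeP[C BC1].
have : \det (A x *m C) @[x --> F] --> (1 : R).
  rewrite -[X in _ --> X](det1 R m) -BC1; apply: cvg_det => i j.
  rewrite mxE; under eq_cvg do rewrite mxE.
  apply: cvg_big => [|k _]; first exact: add_continuous.
  by apply: cvgM; [exact: AB|exact: cvg_cst].
move=> /cvgr_neq0 /(_ (oner_neq0 _)); apply: filterS => x detx.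
have /mulmxV ACK : A x *m C \in unitmx by rewrite unitmxE unitfE.
by apply/row_freeP; exists (C *m invmx (A x *m C)); rewrite mulmxA.
Qed.

Lemma near_free (R : realType) (T I : Type) (F : set_system T)
    {FF : Filter F} (n : nat) (s : seq I) (G : I -> T -> 'rV[R]_n)
    (L : I -> 'rV[R]_n) :
  (forall k i, G k x 0 i @[x --> F] --> L k 0 i) ->
  free [seq L k | k <- s] -> \forall x \near F, free [seq G k x | k <- s].
Proof.
(* The empty family is free; otherwise the head [k0] is kept as the default index for [nth_map]. *)
move=> GL; case: s => [|k0 s].
  by move=> _; apply: nearW => ?; exact: nil_free.
move: (k0 :: s) => {}s.
rewrite -[X in free X](_ : map_tuple L (in_tuple s) = _ :> seq _)//.
rewrite free_row_freeE => freeL.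
have : \forall x \near F,
    row_free (\matrix_(i < size s) (map_tuple (G^~ x) (in_tuple s))`_i).
  apply: near_row_free freeL => i j; rewrite mxE (nth_map k0) //.
  by under eq_cvg do rewrite mxE (nth_map k0) //; exact: GL.
by apply: filterS => x; rewrite -free_row_freeE.
Qed.

End Topology.

Lemma continuous_row_coord (R : realType) (T : topologicalType) (m : nat)
    (g : T -> 'rV[R]_m) (j : 'I_m) :
  continuous g -> continuous (fun x => g x 0 j).
Proof.
move=> cg x; apply: (@continuous_comp _ _ _ g (fun v : 'rV[R]_m => v 0 j)).
  exact: cg.
exact: (@coord_continuous R 1 m 0 j).
Qed.

(** Derivatives of vector-valued maps are taken coordinatewise, so this entry is the [j]-th
    coordinate of the [i]-th partial derivative of [F]. *)
Lemma gradient_component_continuous (R : realType) (n kappa k : nat)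
    (F : 'rV[R]_n -> 'rV[R]_kappa) (hF : Ck k.+1 F) (j : 'I_kappa) (i : 'I_n) :
  continuous (fun x => gradient (component F j) x 0 i).
Proof.
have [_ /(_ i)[dF cF]] := hF.
have cdF : continuous ('D_(delta_mx ord0 i) F) by case: (k) cF => [|?] [].
rewrite (_ : (fun x => _) = (fun x => 'D_(delta_mx ord0 i) F x 0 j)).
  exact: continuous_row_coord.
by apply/funext => x; rewrite derive_mx// !mxE.
Qed.

Lemma near_positive_gt (R : realType) (T : Type) (I : finType)
    (F : set_system T) {FF : Filter F} (g : I -> T -> R) (L : I -> R) :
  (forall i, g i x @[x --> F] --> L i)%classic ->
  exists2 e : R, 0 < e & \forall x \near F, forall i, 0 < L i -> e < g i x.
Proof.
move=> gL.
(* Each of the finitely many conditions holds for all small [e > 0], so some [e] near [0^'+] meets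
   them all; this also covers the case where no [L i] is positive. *)
have [e [e0 eL]] : exists e : R, 0 < e /\ forall i, 0 < L i -> e < L i.
  apply: (@filter_ex _ (0^'+ : set_system R)%classic).
  apply: filterI; first exact: nbhs_right_gt.
  apply: (@filter_forall R I (fun i e => 0 < L i -> e < L i)
    (0^'+)%classic) => i.
  case: (ltP 0 (L i)) => [Li0|_]; last exact: nearW.
  by apply: filterS (nbhs_right_lt Li0) => e.
exists e => //; apply: filter_forall => i.
case: (ltP 0 (L i)) => [Li0|_]; last exact: nearW.
by apply: filterS (cvgr_gt _ (gL i) _ (eL i Li0)) => x.
Qed.

Lemma component_continuous (R : realType) (n kappa k : nat)
    (F : 'rV[R]_n -> 'rV[R]_kappa) (hF : Ck k F) (j : 'I_kappa) :
  continuous (component F j).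
Proof.
have cF : continuous F by case: k hF => [|?] [].
exact: continuous_row_coord.
Qed.

(** Indexing by a sum type turns the two lists of gradients into one family, the form that
    [near_free] takes. *)
Lemma gradient_familyE (R : realType) (n kappa : nat)
    (F1 F2 : 'rV[R]_n -> 'rV[R]_kappa) (J1 J2 : {set 'I_kappa}) (x : 'rV[R]_n) :
  gradient_family F1 F2 J1 J2 x =
  [seq match k with
       | inl j => gradient (component F1 j) x
       | inr j => gradient (component F2 j) x
       end | k <- map inl (enum J1) ++ map inr (enum J2)].
Proof. by rewrite map_cat -!map_comp. Qed.

(** The index sets stay fixed while the point moves, so only continuity of the gradients matters. *)
Lemma near_free_gradient_family (R : realType) (n kappa k : nat)
    (F1 F2 : 'rV[R]_n -> 'rV[R]_kappa) (hF1 : Ck k.+1 F1) (hF2 : Ck k.+1 F2)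
    (J1 J2 : {set 'I_kappa}) (x : 'rV[R]_n) :
  free (gradient_family F1 F2 J1 J2 x) ->
  \forall y \near x, free (gradient_family F1 F2 J1 J2 y).
Proof.
rewrite gradient_familyE => freex.
suff : \forall y \near x, free
    [seq match k with
         | inl j => gradient (component F1 j) y
         | inr j => gradient (component F2 j) y
         end | k <- map inl (enum J1) ++ map inr (enum J2)].
  by apply: filterS => y; rewrite -gradient_familyE.
apply: (@near_free _ _ _ (nbhs x) _ _ _ (fun k y => match k with
  | inl j => gradient (component F1 j) y
  | inr j => gradient (component F2 j) y
  end) _ _ freex) => -[j|j] i.
  exact: (@gradient_component_continuous _ _ _ _ _ hF1).
exact: (@gradient_component_continuous _ _ _ _ _ hF2).
Qed.

Lemma free_gradient_family_subset (R : realType) (n kappa : nat)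
    (F1 F2 : 'rV[R]_n -> 'rV[R]_kappa) (J1 J2 K1 K2 : {set 'I_kappa})
    (x : 'rV[R]_n) :
  J1 \subset K1 -> J2 \subset K2 ->
  free (gradient_family F1 F2 K1 K2 x) -> free (gradient_family F1 F2 J1 J2 x).
Proof.
move=> JK1 JK2; apply: subseq_free.
by apply: cat_subseq; apply: map_subseq; exact: subset_subseq_enum.
Qed.

Theorem theorem1 (R : realType) (n kappa : nat)
  (F1 F2 : 'rV[R]_n -> 'rV[R]_kappa) (f : 'rV[R]_n -> R)
  (hF1 : Ck 2 F1) (hF2 : Ck 2 F2) (hf : Ck 2 f)
  (xbar : 'rV[R]_n) (hxbar : mpcc_feasible F1 F2 xbar)
  (hLICQ : MPCC_LICQ F1 F2 xbar) :
  exists tbar : R, 0 < tbar /\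
  exists U : set 'rV[R]_n, nbhs xbar U /\
    forall t : R, 0 < t -> t < tbar ->
    forall x : 'rV[R]_n, disj_feasible F1 F2 t x -> U x -> DISJ_LICQ F1 F2 t x.
Proof.
have [e1 e1_gt0 near1] := near_positive_gt
  (fun j => @component_continuous _ _ _ _ _ hF1 j xbar).
have [e2 e2_gt0 near2] := near_positive_gt
  (fun j => @component_continuous _ _ _ _ _ hF2 j xbar).
exists (Num.min e1 e2); split; first by rewrite lt_min e1_gt0.
(* [U] is the intersection of three neighborhoods: one keeps the MPCC-LICQ family free, two give the
   lower bounds [e1] and [e2]. *)
eexists; split.
  apply: filterI (near_free_gradient_family hF1 hF2 hLICQ) _.
  exact: filterI near1 near2.
move=> t t0; rewrite lt_min => /andP[te1 te2] x _ [freex [pos1 pos2]].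
apply: free_gradient_family_subset freex; apply/fintype.subsetP => j;
    rewrite !inE; have [_ ge1 ge2] := hxbar j.
- move=> act1; have le1 : component F1 j x <= t.
    by case/orP: act1 => [/orP[]/andP[]|] /eqP->; rewrite ?lexx ?(ltW t0).
  (* A positive value at [xbar] would force [F1] at [x] above [e1 > t], against [le1]. *)
  have /eqP -> : component F1 j xbar == 0.
    rewrite eq_le ge1 andbT leNgt; apply/negP => /pos1.
    by rewrite ltNge (le_trans le1) ?ltW.
  (* Membership in [a01] or [a00] now amounts to [F2] being nonnegative at [xbar]. *)
  by rewrite eqxx orbC eq_sym -le_eqVlt.
- move=> act2; have le2 : component F2 j x <= t.
    by case/orP: act2 => [/orP[]/andP[_]|] /eqP->; rewrite ?lexx ?(ltW t0).
  have /eqP -> : component F2 j xbar == 0.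
    rewrite eq_le ge2 andbT leNgt; apply/negP => /pos2.
    by rewrite ltNge (le_trans le2) ?ltW.
  by rewrite eqxx !andbT orbC eq_sym -le_eqVlt.
Qed.
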